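(* For every integer $n\ge 0$ the following Hankel determinant evaluations hold: $$H_n(a)=\prod_{i=0}^{n-1}\frac{(\frac23)_i(\frac16)_i(\frac43)_i(\frac56)_i}{(\frac12)_{2i}(\frac32)_{2i}}\left(\tfrac{27}{4}\right)^{2i},\qquad H_n^1(a)=\prod_{i=1}^{n}\frac23\,\frac{(\frac23)_i(\frac16)_i(\frac13)_i(-\frac16)_i}{(\frac12)_{2i}(-\frac12)_{2i}}\left(\tfrac{27}{4}\right)^{2i},$$ $$H_n(b)=\prod_{i=0}^{n-1}\frac{(\frac43)_i(\frac56)_i(\frac53)_i(\frac76)_i}{(\frac32)_{2i}(\frac52)_{2i}}\left(\tfrac{27}{4}\right)^{2i},\qquad H_n^1(b)=\prod_{i=1}^{n}\frac{(\frac43)_i(\frac56)_i(\frac23)_i(\frac16)_i}{(\frac32)_{2i}(\frac12)_{2i}}\left(\tfrac{27}{4}\right)^{2i},$$ $$H_n(c)=\prod_{i=0}^{n-1}2\,\frac{(\frac53)_i(\frac76)_i(\frac73)_i(\frac{11}6)_i}{(\frac52)_{2i}(\frac72)_{2i}}\left(\tfrac{27}{4}\right)^{2i},\qquad H_n^1(c)=\prod_{i=1}^{n}\frac{(\frac53)_i(\frac76)_i(\frac43)_i(\frac56)_i}{(\frac52)_{2i}(\frac32)_{2i}}\left(\tfrac{27}{4}\right)^{2i},$$ $$H_n(d)=\prod_{i=0}^{n-1}2\,\frac{(\frac53)_i(\frac16)_i(\frac73)_i(\frac56)_i}{(\frac52)_{2i}(\frac32)_{2i}}\left(\tfrac{27}{4}\right)^{2i},\qquad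 H_n^1(d)=(-1)^n\prod_{i=1}^{n}\frac{(\frac53)_i(\frac16)_i(\frac43)_i(-\frac16)_i}{(\frac32)_{2i}(\frac12)_{2i}}\left(\tfrac{27}{4}\right)^{2i},$$ $$H_n(e)=\prod_{i=0}^{n-1}5\,\frac{(\frac23)_i(\frac76)_i(\frac43)_i(\frac{11}6)_i}{(\frac32)_{2i}(\frac52)_{2i}}\left(\tfrac{27}{4}\right)^{2i},\qquad H_n^1(e)=\prod_{i=1}^{n}2\,\frac{(\frac23)_i(\frac76)_i(\frac13)_i(\frac56)_i}{(\frac32)_{2i}(\frac12)_{2i}}\left(\tfrac{27}{4}\right)^{2i}.$$
   Context: Notation: $(u)_n=u(u+1)\cdots(u+n-1)$. For a sequence $(z_n)_{n\ge0}$ put $H_n(z)=\det(z_{i+j})_{0\le i,j\le n-1}$ and $H_n^1(z)=\det(z_{i+j+1})_{0\le i,j\le n-1}$; $0\times0$ determinants equal $1$. The integer sequences are, for $n\ge 0$, $$a_n=\frac{(3n)!}{n!\,(2n+1)!},\quad b_n=\frac{(3n+1)!}{(n+1)!\,(2n+1)!},\quad c_n=\frac{2\,(3n)!}{(n+1)!\,(2n)!},$$ $$d_n=\frac{2\,(3n)!}{(n+1)!\,(2n+1)!},\quad e_n=\frac{(9n+5)\,(3n)!}{(n+1)!\,(2n+1)!}.$$ *)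

(* Defs.v *)
From mathcomp Require Import all_boot all_order all_algebra.

Set Implicit Arguments.
Unset Strict Implicit.
Unset Printing Implicit Defensive.

Local Open Scope ring_scope.

(* Rising factorial (u)_n = u (u + 1) ... (u + n - 1). *)
Definition poch (u : rat) (n : nat) : rat := \prod_(k < n) (u + k%:R).

Definition hankel (z : nat -> rat) (n : nat) : rat :=
  \det (\matrix_(i < n, j < n) z (i + j)%N).

Definition hankel1 (z : nat -> rat) (n : nat) : rat :=
  \det (\matrix_(i < n, j < n) z (i + j + 1)%N).

(* The sequences are integer valued; they are defined by exact division in    *)
(* rat, so that no truncated division is involved.                            *)
Definition seq_a (n : nat) : rat :=
  ((3 * n)`!)%N%:R / ((n`!)%N%:R * ((2 * n + 1)`!)%N%:R).

Definition seq_b (n : nat) : rat :=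
  ((3 * n + 1)`!)%N%:R / (((n + 1)`!)%N%:R * ((2 * n + 1)`!)%N%:R).

Definition seq_c (n : nat) : rat :=
  2 * ((3 * n)`!)%N%:R / (((n + 1)`!)%N%:R * ((2 * n)`!)%N%:R).

Definition seq_d (n : nat) : rat :=
  2 * ((3 * n)`!)%N%:R / (((n + 1)`!)%N%:R * ((2 * n + 1)`!)%N%:R).

Definition seq_e (n : nat) : rat :=
  (9 * n + 5)%N%:R * ((3 * n)`!)%N%:R
  / (((n + 1)`!)%N%:R * ((2 * n + 1)`!)%N%:R).

(* Main.v *)
Require Import Defs.
From mathcomp Require Import all_boot all_order all_algebra.
From mathcomp Require Import ring lra zify.

Set Implicit Arguments.
Unset Strict Implicit.
Unset Printing Implicit Defensive.

Local Open Scope ring_scope.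
Import Order.TTheory GRing.Theory Num.Theory.

(** Each of the five sequences is, up to the factor [z 0], the quotient
    [F_1 / F_0] of two contiguous hypergeometric series
    [F_0 = 2F1(a, b; c; 27x/4)] and [F_1 = 2F1(a, b+1; c+1; 27x/4)].  Gauss's
    contiguous relation [F_k = F_(k+1) - lam_k x F_(k+2)] ([hyp_contiguous],
    [gaussF_rec]) expands this quotient as a continued fraction
    [1 / (1 - lam_0 x / (1 - lam_1 x / ...))], and the Hankel determinants of
    such a fraction are products of the [lam_k].

    The determinant evaluation works with Bezoutians, which avoids dividing
    series.  Let
      [M_k = (F_(k+1)(x) F_k(y) - F_k(x) F_(k+1)(y)) / (x - y)],
      [N_k = (x F_(k+1)(x) F_k(y) - y F_k(x) F_(k+1)(y)) / (x - y)].
    Substituting the contiguous relation gives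
      [M_k = lam_k N_(k+1)] and
      [N_k = F_(k+1)(x) F_(k+1)(y) + lam_k x y M_(k+1)],
    so that the leading minors obey [det_n M_k = lam_k^n det_n N_(k+1)] and
    [det_(n+1) N_k = lam_k^n det_n M_(k+1)] ([bezoutian_step1],
    [bezoutian_step2], [det_bezoutian_Sfraction]).  On the other hand, if
    [F_0 z = F_1] then [N_0] and [M_0] are [L H L^T], where [H] is the Hankel
    matrix of [z], respectively of the shifted [z], and [L] is the
    unitriangular Toeplitz matrix of [F_0] ([bezoutian_hankel],
    [det_hankel_conj]).

    The identity [F_0 z = z_0 F_1] is a convolution of Rothe-Hagen type.  If
    [B = 1 + x B^3], then [raney n x] is the n-th coefficient of [B^x] and
    [fuss n y] that of [B^y B / (3 - 2B)]; their convolution is computed by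
    [conv_rothe], from the Pascal-type recurrence alone.  All five sequences
    are combinations of [B] and [B^2] ([seq_raney]), and the series [F_0],
    [F_1] are combinations of these two forms; for the fourth sequence they become
    so after multiplication by [1 - 27x/4]. *)

(** * Bezoutians and Stieltjes continued fractions *)

Section Bezoutian.
Variable R : fieldType.
Implicit Types (u v f g w : nat -> R) (m : nat -> nat -> R).

Definition mulX u (i : nat) : R := if i is i'.+1 then u i' else 0.

Definition sqmx m n : 'M[R]_n := \matrix_(i < n, j < n) m i j.

(** Coefficientwise form of [(x - y) m(x, y) = u(x) v(y) - v(x) u(y)]; stating the
    product rather than the quotient makes every step below an identity of
    coefficients. *)
Definition bezoutian m u v := forall i j,
  (if i is i'.+1 then m i' j else 0) - (if j is j'.+1 then m i j' else 0)
  = u i * v j - v i * u j.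

Lemma det_sqmxZ k m n : \det (sqmx (fun i j => k * m i j) n) = k ^+ n * \det (sqmx m n).
Proof.
rewrite -detZ; congr (\det _); apply/matrixP => i j; by rewrite !mxE.
Qed.

Lemma bezoutian_scale k m u v :
  bezoutian m u v -> bezoutian (fun i j => k * m i j) (fun i => k * u i) v.
Proof.
move=> H i j.
have -> : k * u i * v j - v i * (k * u j) = k * (u i * v j - v i * u j) by ring.
by rewrite -H; case: i => [|i]; case: j => [|j]; ring.
Qed.

(** With [v = u - lam x t] one has
    [u(x) v(y) - v(x) u(y) = lam (x t(x) u(y) - y u(x) t(y))]. *)
Lemma bezoutian_step1 lam m u v t :
    lam != 0 -> (forall i, v i = u i - lam * mulX t i) ->
    bezoutian m u v ->
  bezoutian (fun i j => lam^-1 * m i j) (mulX t) u.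
Proof.
move=> l0 Hv H i j; have := H i j; rewrite !Hv => E.
have -> : mulX t i * u j - u i * mulX t j =
   lam^-1 * (u i * (u j - lam * mulX t j) - (u i - lam * mulX t i) * u j).
  by field.
rewrite -E; case: i {E} => [|i]; case: j => [|j]; ring.
Qed.

(** Here [x u(x) v(y) - y v(x) u(y)] equals [(x - y) u(x) u(y)] plus
    [lam x y (t(x) u(y) - u(x) t(y))], so [m] is the rank one matrix [u u^T] plus
    [lam] times the shift of [m'] by one row and one column.  As [u 0 = 1],
    eliminating with the first row and column removes the rank one part and
    leaves the block [lam m']. *)
Lemma bezoutian_step2 lam m u v t :
    lam != 0 -> u 0%N = 1 -> (forall i, v i = u i - lam * mulX t i) ->
    bezoutian m (mulX u) v ->
  exists2 m', bezoutian m' t u &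
    forall n, \det (sqmx m n.+1) = lam ^+ n * \det (sqmx m' n).
Proof.
move=> l0 u0 Hv H.
pose r i j := m i j - u i * u j.
have r0 j : r 0%N j = 0.
  have := H 0%N j.+1; rewrite !Hv /= u0 => E.
  have -> : r 0%N j = - (0 - m 0%N j) - u j by rewrite /r u0; ring.
  by rewrite E; ring.
have r0' i : r i 0%N = 0.
  have := H i.+1 0%N; rewrite !Hv /= u0 => E.
  have -> : r i 0%N = (m i 0%N - 0) - u i by rewrite /r u0; ring.
  by rewrite E; ring.
have rS i j : r i j.+1 - r i.+1 j = lam * (t i * u j - u i * t j).
  have := H i.+1 j.+1; rewrite !Hv /= => E.
  have -> : r i j.+1 - r i.+1 j = (m i j.+1 - m i.+1 j) - (u i * u j.+1 - u i.+1 * u j).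
    by rewrite /r; ring.
  by rewrite E; ring.
exists (fun i j => lam^-1 * r i.+1 j.+1).
  move=> i j.
  have -> : t i * u j - u i * t j = lam^-1 * (r i j.+1 - r i.+1 j).
    by rewrite rS; field.
  case: i => [|i]; case: j => [|j]; rewrite ?r0 ?r0'; ring.
move=> n; rewrite -det_sqmxZ.
pose c : 'cV[R]_n := \col_i u i.+1.
pose M := sqmx (fun i j => lam * (lam^-1 * r i.+1 j.+1)) n.
rewrite -[sqmx m n.+1]/(sqmx m (1 + n)).
have -> : sqmx m (1 + n) = block_mx (1%:M : 'M_1) 0 c 1%:M *m block_mx (1%:M : 'M_1) c^T 0 M.
  rewrite mulmx_block !mulmx1 !mul1mx !mul0mx !addr0.
  apply/matrixP => i j; rewrite [LHS]mxE.
  case: (split_ordP i) => i' ->; case: (split_ordP j) => j' ->.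
  - rewrite block_mxEul !ord1 !mxE /=.
    by have /eqP := r0 0%N; rewrite /r u0 mulr1 subr_eq0 => /eqP.
  - rewrite block_mxEur !ord1 !mxE /=.
    by have /eqP := r0 j'.+1; rewrite /r u0 mul1r subr_eq0 => /eqP.
  - rewrite block_mxEdl !ord1 !mxE /=.
    by have /eqP := r0' i'.+1; rewrite /r u0 mulr1 subr_eq0 => /eqP.
  - rewrite block_mxEdr !mxE big_ord1 !mxE /= /r !add1n.
    by field.
by rewrite (det_mulmx (n := 1 + n)) det_lblock det_ublock !det1 !mul1r.
Qed.

(** The two steps alternate along the fraction: the second minor of order [n]
    reduces to a first one of the same order, for the tail of the family, and
    the first minor of order [n] to a second one of order [n - 1].  The family [F] is
    quantified after [n] because each step replaces it by its tail. *)
Lemma det_bezoutian_Sfraction n : forall (F : nat -> nat -> R) (lam : nat -> R),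
    (forall k, lam k != 0) -> (forall k, F k 0%N = 1) ->
    (forall k i, F k i = F k.+1 i - lam k * mulX (F k.+2) i) ->
  (forall m, bezoutian m (mulX (F 1%N)) (F 0%N) ->
     \det (sqmx m n) = \prod_(i < n) \prod_(j < 2 * i) lam j) /\
  (forall m, bezoutian m (F 1%N) (F 0%N) ->
     \det (sqmx m n) = \prod_(i < n) \prod_(j < (2 * i).+1) lam j).
Proof.
have odd_case F lam n' : (forall k, lam k != 0) ->
    (forall k i, F k i = F k.+1 i - lam k * mulX (F k.+2) i) ->
    (forall m, bezoutian m (mulX (F 2%N)) (F 1%N) ->
     \det (sqmx m n') = \prod_(i < n') \prod_(j < 2 * i) lam j.+1) ->
  (forall m, bezoutian m (F 1%N) (F 0%N) ->
     \det (sqmx m n') = \prod_(i < n') \prod_(j < (2 * i).+1) lam j).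
  move=> l0 HF IH m /(bezoutian_step1 (l0 0%N) (HF 0%N)) /IH.
  rewrite det_sqmxZ => E.
  under eq_bigr do rewrite big_ord_recl.
  rewrite big_split /= prodr_const card_ord -E mulrA -exprMn.
  by rewrite divff // expr1n mul1r.
elim: n => [|n IHn] F lam l0 F0 HF.
  by split=> m _; rewrite big_ord0 det_mx00.
have even_case F' lam' : (forall k, lam' k != 0) -> (forall k, F' k 0%N = 1) ->
    (forall k i, F' k i = F' k.+1 i - lam' k * mulX (F' k.+2) i) ->
  (forall m, bezoutian m (mulX (F' 1%N)) (F' 0%N) ->
     \det (sqmx m n.+1) = \prod_(i < n.+1) \prod_(j < 2 * i) lam' j).
  move=> l0' F0' HF' m Hm.
  have [m' Hm' ->] := bezoutian_step2 (l0' 0%N) (F0' 1%N) (HF' 0%N) Hm.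
  have [_ /(_ m' Hm') ->] := IHn (fun k => F' k.+1) (fun k => lam' k.+1)
    (fun k => l0' k.+1) (fun k => F0' k.+1) (fun k => HF' k.+1).
  rewrite [RHS]big_ord_recl big_ord0 mul1r.
  have e (i : nat) : (2 * i.+1 = (2 * i).+2)%N by rewrite mulnS.
  under [RHS]eq_bigr => i _ do rewrite lift0 e big_ord_recl.
  by rewrite big_split /= prodr_const card_ord.
split; first exact: even_case.
apply: odd_case => // m.
exact: (even_case (fun k => F k.+1) (fun k => lam k.+1)).
Qed.

(** Coefficients of a product of two power series. *)
Definition conv f w i : R := \sum_(p < i.+1) f (i - p)%N * w p.

Lemma convS f w i :
  conv f w i.+1 = f i.+1 * w 0%N + conv f (fun p => w p.+1) i.
Proof. by rewrite /conv big_ord_recl subn0. Qed.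

Lemma eq_convl f g w : f =1 g -> conv f w =1 conv g w.
Proof. by move=> e i; apply: eq_bigr => p _; rewrite e. Qed.

Lemma eq_convr f w v : w =1 v -> conv f w =1 conv f v.
Proof. by move=> e i; apply: eq_bigr => p _; rewrite e. Qed.

Lemma convDr h k f w v i :
  conv f (fun p => h * w p + k * v p) i = h * conv f w i + k * conv f v i.
Proof. by rewrite /conv !big_distrr -big_split; apply: eq_bigr => p _ /=; ring. Qed.

Lemma convDl h k f g w i :
  conv (fun p => h * f p + k * g p) w i = h * conv f w i + k * conv g w i.
Proof. by rewrite /conv !big_distrr -big_split; apply: eq_bigr => p _ /=; ring. Qed.

Lemma conv_mulX f w i : conv (mulX f) w i = mulX (conv f w) i.
Proof.
case: i => [|i]; first by rewrite /conv big_ord1 mul0r.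
rewrite /conv big_ord_recr /= subnn mul0r addr0.
by apply: eq_bigr => p _; rewrite subSn // -ltnS.
Qed.

(** The series [1 - X x] can be cancelled from [f w = k f']. *)
Lemma conv_cancel X f f' w k :
    (forall i, conv (fun p => f p - X * mulX f p) w i = k * (f' i - X * mulX f' i)) ->
  forall i, conv f w i = k * f' i.
Proof.
move=> H; have {}H i : conv f w i - X * mulX (conv f w) i = k * (f' i - X * mulX f' i).
  rewrite -H -conv_mulX -[LHS]addr0 /conv big_distrr /= addr0 -sumrB.
  by apply: eq_bigr => p _; ring.
elim=> [|i IH].
  by have := H 0%N; rewrite /= !mulr0 !subr0.
have := H i.+1; rewrite /= IH => /eqP; rewrite subr_eq => /eqP ->; ring.
Qed.

(** Entries of [L H L^T], with [L] the lower triangular Toeplitz matrix of [f] and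
    [H] the Hankel matrix of [w]. *)
Definition hankel_conj f w i j : R :=
  \sum_(p < i.+1) f (i - p)%N * conv f (fun q => w (p + q)%N) j.

(** The Hankel matrix of [w] has the generating function
    [(x w(x) - y w(y)) / (x - y)]; multiplying by [f(x) f(y)] turns the numerator
    into [x (f w)(x) f(y) - y f(x) (f w)(y)]. *)
Lemma bezoutian_hankel f w : bezoutian (hankel_conj f w) (mulX (conv f w)) f.
Proof.
have row0 j : hankel_conj f w 0 j = f 0%N * conv f w j.
  by rewrite /hankel_conj big_ord1 subn0.
have col0 i : hankel_conj f w i 0 = f 0%N * conv f w i.
  rewrite /hankel_conj /conv big_distrr /=; apply: eq_bigr => p _.
  by rewrite big_ord1 subn0 addn0; ring.
case=> [|i] [|j] /=; rewrite ?row0 ?col0; try ring.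
have -> : hankel_conj f w i.+1 j = f i.+1 * conv f w j +
   \sum_(p < i.+1) f (i - p)%N * conv f (fun q => w (p + q.+1)%N) j.
  rewrite /hankel_conj big_ord_recl subn0 /=; congr (_ + _).
  apply: eq_bigr => p _; congr (_ * _); apply: eq_bigr => q _.
  by rewrite /bump /= add1n addSnnS.
have -> : hankel_conj f w i j.+1 = conv f w i * f j.+1 +
   \sum_(p < i.+1) f (i - p)%N * conv f (fun q => w (p + q.+1)%N) j.
  rewrite /hankel_conj {2}/conv big_distrl -big_split /=.
  by apply: eq_bigr => p _; rewrite convS addn0; ring.
ring.
Qed.

Lemma big_ord_triangle n i (G : nat -> R) : (i < n)%N ->
  \sum_(p < n) (if (p <= i)%N then G p else 0) = \sum_(p < i.+1) G p.
Proof.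
move=> lin; rewrite (big_ord_widen _ G lin) [RHS]big_mkcond /=.
by apply: eq_bigr => p _; rewrite ltnS.
Qed.

Lemma det_hankel_conj f w n : f 0%N = 1 ->
  \det (sqmx (hankel_conj f w) n) = \det (sqmx (fun i j => w (i + j)%N) n).
Proof.
move=> f0; pose L : 'M[R]_n := sqmx (fun i p => if (p <= i)%N then f (i - p)%N else 0) n.
have detL : \det L = 1.
  rewrite det_trig; last first.
    by apply/is_trig_mxP => i j lij; rewrite mxE leqNgt lij.
  by apply: big1 => i _; rewrite mxE leqnn subnn.
have -> : sqmx (hankel_conj f w) n = L *m (sqmx (fun i j => w (i + j)%N) n *m L^T).
  apply/matrixP => i j; rewrite !mxE /hankel_conj.
  rewrite -(big_ord_triangle (fun p => f (i - p)%N * conv f (fun q => w (p + q)%N) j) (ltn_ord i)).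
  apply: eq_bigr => p _; rewrite !mxE; case: ifP => _; last by rewrite mul0r.
  congr (_ * _); rewrite /conv -(big_ord_triangle (fun q => f (j - q)%N * w (p + q)%N) (ltn_ord j)).
  by apply: eq_bigr => q _; rewrite !mxE; case: ifP => _; rewrite ?mulr0 // mulrC.
by rewrite !det_mulmx det_tr detL mul1r mulr1.
Qed.

(** The shifted determinant fits the same frame: the series of [k |-> z k.+1] is
    [(z - z_0) / x], so its product with [F_0] times [x] is
    [kap F_1 - z_0 F_0], and the multiple of [F_0] drops out of the Bezoutian. *)
Lemma hankel_Sfraction (F : nat -> nat -> R) (lam : nat -> R) (z : nat -> R) kap n :
    (forall k, lam k != 0) -> (forall k, F k 0%N = 1) ->
    (forall k i, F k i = F k.+1 i - lam k * mulX (F k.+2) i) ->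
    kap != 0 -> (forall i, conv (F 0%N) z i = kap * F 1%N i) ->
  \det (sqmx (fun i j => z (i + j)%N) n) =
     \prod_(i < n) (kap * \prod_(j < 2 * i) lam j) /\
  \det (sqmx (fun i j => z (i + j + 1)%N) n) =
     \prod_(i < n) (kap * \prod_(j < (2 * i).+1) lam j).
Proof.
move=> l0 F0 HF k0 Hz.
have [He Ho] := det_bezoutian_Sfraction n l0 F0 HF.
have scale (w : nat -> R) u (P : nat -> R) :
    (forall m, bezoutian m u (F 0%N) -> \det (sqmx m n) = \prod_(i < n) P i) ->
    bezoutian (fun i j => kap^-1 * hankel_conj (F 0%N) w i j) u (F 0%N) ->
  \det (sqmx (fun i j => w (i + j)%N) n) = \prod_(i < n) (kap * P i).
  move=> HP /HP; rewrite det_sqmxZ det_hankel_conj // => E.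
  by rewrite big_split /= -E prodr_const card_ord mulrA -exprMn divff // expr1n mul1r.
split.
  apply: (scale z _ (fun i => \prod_(j < 2 * i) lam j) He) => i j.
  rewrite (bezoutian_scale kap^-1 (@bezoutian_hankel (F 0%N) z) i j).
  have e k : kap^-1 * mulX (conv (F 0%N) z) k = mulX (F 1%N) k.
    by case: k => [|k] /=; rewrite ?mulr0 // Hz; field.
  by rewrite !e.
rewrite -(scale (fun k => z k.+1) _ (fun i => \prod_(j < (2 * i).+1) lam j) Ho).
  by congr (\det _); apply/matrixP => i j; rewrite !mxE addn1.
move=> i j.
rewrite (bezoutian_scale kap^-1 (@bezoutian_hankel (F 0%N) (fun k => z k.+1)) i j).
have e k : mulX (conv (F 0%N) (fun k => z k.+1)) k = kap * F 1%N k - z 0%N * F 0%N k.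
  case: k => [|k] /=; last by rewrite -Hz convS; ring.
  by rewrite -Hz /conv big_ord1 subn0 F0; ring.
by rewrite !e; field.
Qed.

End Bezoutian.

(** * Gauss's continued fraction *)

Lemma pochS u n : poch u n.+1 = poch u n * (u + n%:R).
Proof. by rewrite /poch big_ord_recr. Qed.

Lemma pochSl u n : poch u n.+1 = u * poch (u + 1) n.
Proof.
rewrite /poch big_ord_recl addr0; congr (_ * _).
by apply: eq_bigr => k _; rewrite lift0 -addrA -natr1 [1 + _]addrC.
Qed.

Lemma poch0 u : poch u 0 = 1.
Proof. exact: big_ord0. Qed.

Lemma poch_gt0 (u : rat) n : 0 < u -> 0 < poch u n.
Proof. by move=> u0; apply: prodr_gt0 => k _; rewrite ltr_wpDr. Qed.

Lemma poch_neq0 (u : rat) n : 0 < u -> poch u n != 0.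
Proof. by move=> u0; rewrite gt_eqF ?poch_gt0. Qed.

(** Coefficients of [2F1(a, b; c; X x)]. *)
Definition hyp (X a b c : rat) (n : nat) : rat :=
  poch a n * poch b n / (poch c n * n`!%:R) * X ^+ n.

Lemma fact_rat_neq0 n : (n`!)%:R != 0 :> rat.
Proof. by rewrite pnatr_eq0 -lt0n fact_gt0. Qed.

Lemma hyp0 X a b c : hyp X a b c 0 = 1.
Proof. by rewrite /hyp !poch0 fact0; field. Qed.

Lemma hyp_rec X a b (c : rat) n : 0 < c ->
  hyp X a b c n.+1 = hyp X a b c n * (X * (a + n%:R) * (b + n%:R) / ((c + n%:R) * n.+1%:R)).
Proof.
move=> c0; rewrite /hyp !pochS factS natrM exprS.
have := fact_rat_neq0 n; have := poch_neq0 n c0 => p1 p2.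
have p3 : c + n%:R != 0 by rewrite gt_eqF // ltr_wpDr.
have p4 : 1 + n%:R != 0 :> rat by rewrite nat1r pnatr_eq0.
by field; rewrite p1 p2 p3 p4.
Qed.

(** Since [hyp] is symmetric in its two numerator parameters, the right-hand side
    is again a pair to which the lemma applies, with [(a, b, c)] replaced by
    [(b + 1, a, c + 1)]; iterating it gives the whole continued fraction. *)
Lemma hyp_contiguous X a b (c : rat) n : 0 < c ->
  hyp X a b c n = hyp X (b + 1) a (c + 1) n
    - X * a * (c - b) / (c * (c + 1)) * mulX (hyp X (a + 1) (b + 1) (c + 2)) n.
Proof.
move=> c0; case: n => [|n] /=; first by rewrite !hyp0 mulr0 subr0.
have p1 : c != 0 by rewrite gt_eqF.
have c1 : 0 < c + 1 by rewrite addr_gt0.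
have p2 : c + 1 != 0 by rewrite gt_eqF.
have p3 : c + 1 + n%:R != 0 by rewrite gt_eqF // ltr_wpDr.
have p4 := poch_neq0 n c1.
have p5 := fact_rat_neq0 n.
have p6 : 1 + n%:R != 0 :> rat by rewrite nat1r pnatr_eq0.
have e : poch (c + 2) n = poch (c + 1) n * (c + 1 + n%:R) / (c + 1).
  rewrite -pochS pochSl (_ : c + 1 + 1 = c + 2); last by ring.
  by field.
rewrite /hyp e (pochSl a) (pochSl b) (pochSl c) (pochS (b + 1)) (pochS (c + 1)) factS natrM.
rewrite exprS; field.
by rewrite p1 p2 p3 p4 p5 p6.
Qed.

Section GaussFraction.
Variables X a b c : rat.
Hypotheses (X_gt0 : 0 < X) (a_gt0 : 0 < a) (b_gt0 : 0 < b) (c_gt0 : 0 < c).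
Hypotheses (cb_gt0 : 0 < c - b) (ca_gt0 : 0 < c - a + 1).

(** [numA k], [numB k] and [den k] are the parameters after [k] iterations of
    [(a, b, c) |-> (b + 1, a, c + 1)]. *)
Definition numA k : rat := (if odd k then b else a) + (uphalf k)%:R.
Definition numB k : rat := (if odd k then a else b) + (k./2)%:R.
Definition den k : rat := c + k%:R.
Definition gaussF k := hyp X (numA k) (numB k) (den k).
Definition gausslam k := X * numA k * (den k - numB k) / (den k * (den k + 1)).

Lemma numAS k : numA k.+1 = numB k + 1.
Proof. by rewrite /numA /numB /= -natr1 if_neg; case: ifP => _; ring. Qed.

Lemma numBS k : numB k.+1 = numA k.
Proof. by rewrite /numA /numB /= if_neg. Qed.

Lemma den_gt0 k : 0 < den k.
Proof. by rewrite ltr_wpDr. Qed.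

Lemma gaussF_rec k i :
  gaussF k i = gaussF k.+1 i - gausslam k * mulX (gaussF k.+2) i.
Proof.
rewrite /gaussF hyp_contiguous ?den_gt0 // !numAS !numBS numAS.
have -> : den k.+1 = den k + 1 by rewrite /den -natr1 addrA.
by have -> : den k.+2 = den k + 2 by rewrite /den -addn2 natrD addrA.
Qed.

Lemma gausslam_neq0 k : gausslam k != 0.
Proof.
rewrite gt_eqF // /gausslam.
have A0 : 0 < numA k by rewrite /numA ltr_wpDr //; case: ifP.
have d0 := den_gt0 k.
have B0 : 0 < den k - numB k.
  have -> : den k = c + ((odd k)%:R + (k./2%:R + k./2%:R)).
    by rewrite /den -{1}(odd_double_half k) -addnn !natrD.
  rewrite /numB; move: (k./2%:R) (ler0n rat k./2) => h h0.
  by move: cb_gt0 ca_gt0; case: (odd k) => /=; lra.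
by rewrite divr_gt0 ?mulr_gt0 // addr_gt0.
Qed.

Lemma prod_gausslam_odd i : \prod_(j < (2 * i).+1) gausslam j =
  \prod_(j < 2 * i) gausslam j
  * (X * (a + i%:R) * (c - b + i%:R) / ((c + (2 * i)%:R) * (c + 1 + (2 * i)%:R))).
Proof.
rewrite big_ord_recr /=; congr (_ * _).
rewrite /gausslam /numA /numB /den mul2n odd_double doubleK uphalf_double -addnn natrD.
by congr (_ * _ / (_ * _)); ring.
Qed.

Lemma prod_gausslam i : \prod_(j < 2 * i) gausslam j =
  poch a i * poch (c - b) i * poch (b + 1) i * poch (c - a + 1) i
  / (poch c (2 * i) * poch (c + 1) (2 * i)) * X ^+ (2 * i).
Proof.
elim: i => [|i IH]; first by rewrite muln0 big_ord0 !poch0 expr0; field.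
have e : (2 * i.+1 = (2 * i).+2)%N by rewrite mulnS.
rewrite e big_ord_recr /= prod_gausslam_odd IH.
rewrite /gausslam /numA /numB /den /= mul2n odd_double /= uphalf_double doubleK -mul2n.
rewrite !pochS !exprS.
have c1 : 0 < c + 1 by rewrite addr_gt0.
have p1 := poch_neq0 (2 * i) c_gt0.
have p2 := poch_neq0 (2 * i) c1.
have eN : (2 * i)%:R = 2 * i%:R :> rat by rewrite natrM.
have eN1 : (2 * i).+1%:R = 2 * i%:R + 1 :> rat by rewrite -natr1 natrM.
have eN2 : i.+1%:R = i%:R + 1 :> rat by rewrite -natr1.
have i0 := ler0n rat i.
rewrite eN eN1 eN2; move: (poch _ _) (poch _ _) p1 p2 (X ^+ _).
move: (i%:R) i0 => x x0 P Q p1 p2 Y; field.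
by rewrite p1 p2 /=; apply/and3P; split; rewrite gt_eqF //; move: c_gt0; lra.
Qed.

Variables (z : nat -> rat) (kap : rat).
Hypothesis kap_neq0 : kap != 0.
Hypothesis conv_z : forall i, conv (hyp X a b c) z i = kap * hyp X a (b + 1) (c + 1) i.

Lemma hankel_gauss_both n :
  hankel z n = \prod_(i < n) (kap * \prod_(j < 2 * i) gausslam j) /\
  hankel1 z n = \prod_(i < n) (kap * \prod_(j < (2 * i).+1) gausslam j).
Proof.
apply: (@hankel_Sfraction _ gaussF).
- exact: gausslam_neq0.
- by move=> k; exact: hyp0.
- exact: gaussF_rec.
- exact: kap_neq0.
move=> i; have -> : conv (gaussF 0) z i = conv (hyp X a b c) z i.
  by rewrite /gaussF /numA /numB /den /= !addr0.
by rewrite conv_z /gaussF /numA /numB /den /= addr0 /hyp [poch a i * _]mulrC.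
Qed.

Lemma hankel_gauss n : hankel z n =
  \prod_(0 <= i < n)
    (kap * ((poch a i * poch (c - b) i * poch (b + 1) i * poch (c - a + 1) i)
      / (poch c (2 * i) * poch (c + 1) (2 * i))) * X ^+ (2 * i)).
Proof.
rewrite (hankel_gauss_both n).1 big_mkord; apply: eq_bigr => i _.
by rewrite prod_gausslam mulrA.
Qed.

(** Raising the lower index to 1 and using [(b + 1)_i = (b)_(i+1) / b] and its
    analogues puts the product in terms of [b], [c - a] and [c - 1]; the constant
    collects the factors so released. *)
Lemma hankel1_gauss n : c != a -> c != 1 -> hankel1 z n =
  \prod_(1 <= i < n.+1)
    (kap * c * (c - 1) / (X * b * (c - a)) *
      ((poch a i * poch (c - b) i * poch b i * poch (c - a) i)
      / (poch c (2 * i) * poch (c - 1) (2 * i))) * X ^+ (2 * i)).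
Proof.
move=> ca c1; rewrite (hankel_gauss_both n).2 big_add1 big_mkord; apply: eq_bigr => i _.
rewrite prod_gausslam_odd prod_gausslam.
have e : (2 * i.+1 = (2 * i).+2)%N by rewrite mulnS.
rewrite e (pochS a) (pochS (c - b)) (pochSl b) (pochSl (c - a)) (pochSl (c - 1)).
rewrite (_ : c - 1 + 1 = c); last by ring.
rewrite [poch c (2 * i).+2]pochSl pochS (pochSl c (2 * i)).
have e2 : poch c (2 * i) = c * poch (c + 1) (2 * i) / (c + (2 * i)%:R).
  rewrite -pochSl pochS mulfK // gt_eqF // ltr_wpDr //.
have c2 : 0 < c + 1 by rewrite addr_gt0.
have p2 := poch_neq0 (2 * i) c2.
rewrite e2 !exprS.
have i0 := ler0n rat (2 * i).
have q1 : c != 0 by rewrite gt_eqF.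
have q2 : b != 0 by rewrite gt_eqF.
have q3 : X != 0 by rewrite gt_eqF.
have q4 : c - a != 0 by rewrite subr_eq0.
have q5 : c - 1 != 0 by rewrite subr_eq0.
have q6 : c + (2 * i)%:R != 0 by rewrite gt_eqF // ltr_wpDr.
have q7 : c + 1 + (2 * i)%:R != 0 by rewrite gt_eqF // ltr_wpDr.
rewrite natrM in q6 q7.
by field; rewrite p2 q1 q2 q3 q4 q5 q6 q7.
Qed.

End GaussFraction.

(** * Convolutions of Rothe-Hagen type *)

(** The n-th coefficient of [B^(y+1) / (3 - 2B)], where [B = 1 + x B^3]. *)
Definition fuss n y : rat := 'C(3 * n + y, n)%:R.

(** The n-th coefficient of [B^x], that is [x / (3n + x)] times [C(3n + x, n)].
    Written as a combination of [fuss], it is defined for [x = n = 0] and inherits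
    the recurrence of [fuss] by linearity. *)
Definition raney n x : rat :=
  if n is n'.+1 then fuss n x - 3 * fuss n' (x + 2) else 1.

(** The coefficients of [g B^y], for a fixed series [g], satisfy this recurrence,
    because [B^(y+1) = B^y + x B^(y+3)]. *)
Definition rothe_family (r : nat -> nat -> rat) :=
  (forall y, r 0%N y.+1 = r 0%N y) /\
  (forall n y, r n.+1 y.+1 = r n.+1 y + r n (y + 3)%N).

Lemma fuss_rothe : rothe_family fuss.
Proof.
split=> [y|n y]; first by rewrite /fuss !bin0.
rewrite /fuss addnS binS natrD; congr (_ + ('C(_, _))%:R); lia.
Qed.

Lemma raney_rothe : rothe_family raney.
Proof.
have [Q0 QS] := fuss_rothe; split=> // -[|n] y; rewrite /= !QS.
  by rewrite /fuss !bin0; ring.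
rewrite -!addnA; ring.
Qed.

(** [B^0 = 1]. *)
Lemma raney0 n : raney n.+1 0 = 0.
Proof.
apply/eqP; rewrite /raney /fuss subr_eq0 -(natrM _ 3) eqr_nat.
rewrite -(eqn_pmul2l (ltn0Sn n)) addn0 -mul_bin_diag; apply/eqP.
have -> : (3 * n + (0 + 2) = (3 * n.+1).-1)%N by lia.
lia.
Qed.

(** [B^x (g B^y) = g B^(x+y)].  Both sides satisfy the same recurrence in [x], which
    lowers [n], and they agree for [x = 0]; so an induction on [n], with an inner
    induction on [x], suffices. *)
Lemma conv_rothe r : rothe_family r -> forall n x y,
  conv (r^~ y) (raney^~ x) n = r n (x + y)%N.
Proof.
move=> [r0 rS]; elim=> [|n IHn] x y.
  rewrite /conv big_ord1 mulr1; elim: x => [|x IHx] //=.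
  by rewrite addSn r0.
elim: x => [|x IHx].
  rewrite convS /= mulr1 /conv big1 ?addr0 // => p _.
  by have /= -> := raney0 p; rewrite mulr0.
have [_ PS] := raney_rothe.
rewrite convS (@eq_convr _ _ _ (fun p => 1 * raney p.+1 x + 1 * raney p (x + 3)%N)); last first.
  by move=> p; rewrite PS !mul1r.
rewrite convDr !mul1r addrA IHn addSn rS -IHx convS /=.
by congr (_ + r n _); lia.
Qed.

Lemma fussE n y : fuss n y = (3 * n + y)`!%:R / (n`!%:R * (2 * n + y)`!%:R).
Proof.
have le : (n <= 3 * n + y)%N by lia.
rewrite /fuss -(bin_fact le) (_ : 3 * n + y - n = 2 * n + y)%N; last by lia.
rewrite !natrM mulfK // mulf_neq0 ?fact_rat_neq0 //.
Qed.

Lemma factS_rat n : (n.+1)`!%:R = (n%:R + 1) * n`!%:R :> rat.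
Proof. by rewrite factS natrM -natr1. Qed.

Lemma fussSr n y :
  fuss n y.+1 = fuss n y * (3 * n%:R + y%:R + 1) / (2 * n%:R + y%:R + 1).
Proof.
rewrite !fussE !addnS !factS_rat.
have := fact_rat_neq0 n; have := fact_rat_neq0 (2 * n + y) => h1 h2.
field; rewrite h1 h2 gt_eqF //.
have := ler0n rat n; have := ler0n rat y; lra.
Qed.

Lemma fussSl n : fuss n.+1 0 =
  fuss n 0 * (3 * (3 * n%:R + 1) * (3 * n%:R + 2)) / ((2 * n%:R + 1) * (2 * n%:R + 2)).
Proof.
rewrite !fussE !addn0.
have -> : (3 * n.+1 = (3 * n).+3)%N by lia.
have -> : (2 * n.+1 = (2 * n).+2)%N by lia.
rewrite !factS_rat.
have := fact_rat_neq0 n; have := fact_rat_neq0 (2 * n) => h1 h2.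
have x0 := ler0n rat n.
field; rewrite h1 h2 !gt_eqF //; lra.
Qed.

Lemma raneyS n x : raney n x.+1 = (x%:R + 1) / (2 * n%:R + x%:R + 1) * fuss n x.
Proof.
have x0 := ler0n rat x.
case: n => [|n]; first by rewrite /fuss bin0 /=; field; rewrite gt_eqF //; lra.
have n0 := ler0n rat n.
rewrite /= !fussE.
have -> : (3 * n.+1 + x.+1 = (3 * n + x + 3).+1)%N by lia.
have -> : (3 * n + (x.+1 + 2) = (3 * n + x + 3))%N by lia.
have -> : (3 * n.+1 + x = (3 * n + x + 3))%N by lia.
have -> : (2 * n.+1 + x.+1 = (2 * n + x).+3)%N by lia.
have -> : (2 * n.+1 + x = (2 * n + x).+2)%N by lia.
have -> : (2 * n + (x.+1 + 2) = (2 * n + x).+3)%N by lia.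
rewrite !factS_rat.
have := fact_rat_neq0 n; have := fact_rat_neq0 (2 * n + x) => h1 h2.
field; rewrite h1 h2 !gt_eqF //; lra.
Qed.

(** * The five sequences and their hypergeometric series *)

Lemma seq_fuss n : [/\ seq_a n = fuss n 0 / (2 * n%:R + 1),
  seq_b n = (3 * n%:R + 1) / ((n%:R + 1) * (2 * n%:R + 1)) * fuss n 0,
  seq_c n = 2 / (n%:R + 1) * fuss n 0,
  seq_d n = 2 / ((n%:R + 1) * (2 * n%:R + 1)) * fuss n 0 &
  seq_e n = (9 * n%:R + 5) / ((n%:R + 1) * (2 * n%:R + 1)) * fuss n 0].
Proof.
have n0 := ler0n rat n.
have := fact_rat_neq0 n; have := fact_rat_neq0 (2 * n) => h1 h2.
rewrite fussE !addn0 /seq_a /seq_b /seq_c /seq_d /seq_e !addn1 !factS_rat.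
split; field; rewrite ?h1 ?h2 ?gt_eqF //; lra.
Qed.

Lemma raney12 n :
  raney n 1 = fuss n 0 / (2 * n%:R + 1) /\
  raney n 2 = (3 * n%:R + 1) / ((n%:R + 1) * (2 * n%:R + 1)) * fuss n 0.
Proof.
have n0 := ler0n rat n.
by rewrite !raneyS fussSr; split; field; rewrite ?gt_eqF //; lra.
Qed.

(** The five sequences are [(3n)! / ((n+1)! (2n+1)!)] times [n + 1], [3n + 1],
    [4n + 2], [2] and [9n + 5], which are all combinations of the first two. *)
Lemma seq_raney n : [/\ seq_a n = raney n 1, seq_b n = raney n 2,
  seq_c n = 1 * raney n 1 + 1 * raney n 2,
  seq_d n = 3 * raney n 1 + (-1) * raney n 2 &
  seq_e n = 3 * raney n 1 + 2 * raney n 2].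
Proof.
have n0 := ler0n rat n.
have [-> -> -> -> ->] := seq_fuss n; have [-> ->] := raney12 n.
by split=> //; field; rewrite ?gt_eqF //; lra.
Qed.

(** Inverse of the radius of convergence of [B]. *)
Definition invradius : rat := 27 / 4.

(** A hypergeometric term is determined by its first value and its term ratio. *)
Lemma hyp_closed a b c (g : nat -> rat) : 0 < c -> g 0%N = 1 ->
    (forall n, g n.+1 = g n * (invradius * (a + n%:R) * (b + n%:R) / ((c + n%:R) * (n%:R + 1)))) ->
  forall n, hyp invradius a b c n = g n.
Proof.
move=> c0 g0 gS; elim=> [|n IH]; first by rewrite hyp0.
by rewrite hyp_rec // IH gS natr1.
Qed.

Ltac closed := let n := fresh "n" in let n0 := fresh "n0" in
  apply: hyp_closed => [||n];
  [lra|by rewrite ?raneyS /fuss !bin0 /=; field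
  |rewrite ?raneyS ?fussSr fussSl /invradius; rewrite -?[n.+1%:R]natr1;
   have n0 := ler0n rat n; move: (fuss n 0) (n%:R) n0 => q x x0;
   field; rewrite ?gt_eqF //; lra].

(** Closed forms of the series [F_0] (suffix 0) and [F_1] (suffix 1) of each of the
    five sequences. *)
Lemma hyp_a0 n : hyp invradius (2/3) (1/3) (1/2) n = fuss n 0.
Proof. move: n. closed. Qed.
Lemma hyp_a1 n : hyp invradius (2/3) (1/3+1) (1/2+1) n = fuss n 1.
Proof. move: n. closed. Qed.
Lemma hyp_b0 n : hyp invradius (4/3) (2/3) (3/2) n = fuss n 1.
Proof. move: n. closed. Qed.
Lemma hyp_b1 n : hyp invradius (4/3) (2/3+1) (3/2+1) n = fuss n 3.
Proof. move: n. closed. Qed.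
Lemma hyp_c0 n : hyp invradius (5/3) (4/3) (5/2) n = fuss n 3.
Proof. move: n. closed. Qed.
Lemma hyp_c1 n : hyp invradius (5/3) (4/3+1) (5/2+1) n = (fuss n 4 + fuss n 5) / 2.
Proof. move: n. closed. Qed.
Lemma hyp_e0 n : hyp invradius (2/3) (1/3) (3/2) n = raney n 1.
Proof. move: n. closed. Qed.
Lemma hyp_e1 n : hyp invradius (2/3) (1/3+1) (3/2+1) n = (3 * raney n 2 + 2 * raney n 3) / 5.
Proof. move: n. closed. Qed.
Lemma hyp_d0 n : hyp invradius (5/3) (4/3) (3/2) n = (n%:R + 1) * fuss n 2.
Proof. move: n. closed. Qed.
Lemma hyp_d1 n : hyp invradius (5/3) (4/3+1) (3/2+1) n =
   3 * (3 * n%:R + 4) * (n%:R + 1) / (4 * (2 * n%:R + 3)) * fuss n 2.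
Proof. move: n. closed. Qed.

Lemma invradius_gt0 : 0 < invradius. Proof. by rewrite /invradius; lra. Qed.

Lemma conv_a n :
  conv (hyp invradius (2/3) (1/3) (1/2)) seq_a n = 1 * hyp invradius (2/3) (1/3+1) (1/2+1) n.
Proof.
rewrite (eq_convl _ hyp_a0) hyp_a1 mul1r -(conv_rothe fuss_rothe n 1 0).
by apply: eq_convr => k; case: (seq_raney k).
Qed.

Lemma conv_b n :
  conv (hyp invradius (4/3) (2/3) (3/2)) seq_b n = 1 * hyp invradius (4/3) (2/3+1) (3/2+1) n.
Proof.
rewrite (eq_convl _ hyp_b0) hyp_b1 mul1r -(conv_rothe fuss_rothe n 2 1).
by apply: eq_convr => k; case: (seq_raney k).
Qed.

Lemma conv_c n :
  conv (hyp invradius (5/3) (4/3) (5/2)) seq_c n = 2 * hyp invradius (5/3) (4/3+1) (5/2+1) n.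
Proof.
rewrite (eq_convl _ hyp_c0) hyp_c1.
rewrite (@eq_convr _ _ _ (fun k => 1 * raney k 1 + 1 * raney k 2)); last first.
  by move=> k; case: (seq_raney k).
by rewrite convDr !(conv_rothe fuss_rothe) /=; field.
Qed.

Lemma conv_e n :
  conv (hyp invradius (2/3) (1/3) (3/2)) seq_e n = 5 * hyp invradius (2/3) (1/3+1) (3/2+1) n.
Proof.
rewrite (eq_convl _ hyp_e0) hyp_e1.
rewrite (@eq_convr _ _ _ (fun k => 3 * raney k 1 + 2 * raney k 2)); last first.
  by move=> k; case: (seq_raney k).
by rewrite convDr !(conv_rothe raney_rothe); field.
Qed.

(** In terms of [B], the series for the fourth sequence is [B^4 / (3 - 2B)^3],
    which is not of the form handled by [conv_rothe].  As
    [1 - 27x/4 = (3 - 2B)^2 (B + 3) / (4 B^3)], the factor [1 - 27x/4] reduces it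
    to [(3B + B^2) / (4 (3 - 2B))]. *)
Lemma mulX_hyp_d0 n :
  hyp invradius (5/3) (4/3) (3/2) n - invradius * mulX (hyp invradius (5/3) (4/3) (3/2)) n
  = 3/4 * fuss n 0 + 1/4 * fuss n 1.
Proof.
case: n => [|n] /=; first by rewrite hyp0 /fuss !bin0; field.
have n0 := ler0n rat n.
rewrite !hyp_d0 !fussSr fussSl -?[n.+1%:R]natr1 /invradius.
by move: (fuss n 0) (n%:R) n0 => q x x0; field; rewrite ?gt_eqF //; lra.
Qed.

Lemma mulX_hyp_d1 n :
  hyp invradius (5/3) (4/3+1) (3/2+1) n - invradius * mulX (hyp invradius (5/3) (4/3+1) (3/2+1)) n
  = (9 * fuss n 1 - fuss n 3) / 8.
Proof.
case: n => [|n] /=; first by rewrite hyp0 /fuss !bin0; field.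
have n0 := ler0n rat n.
rewrite !hyp_d1 !fussSr fussSl -?[n.+1%:R]natr1 /invradius.
by move: (fuss n 0) (n%:R) n0 => q x x0; field; rewrite ?gt_eqF //; lra.
Qed.

Lemma conv_d n :
  conv (hyp invradius (5/3) (4/3) (3/2)) seq_d n = 2 * hyp invradius (5/3) (4/3+1) (3/2+1) n.
Proof.
move: n; apply: (@conv_cancel _ invradius) => n.
rewrite (eq_convl _ mulX_hyp_d0) mulX_hyp_d1.
rewrite (@eq_convr _ _ _ (fun k => 3 * raney k 1 + (-1) * raney k 2)); last first.
  by move=> k; case: (seq_raney k).
by rewrite convDr !convDl !(conv_rothe fuss_rothe) /=; field.
Qed.

(** Instances of Gauss's fraction in which the parameters [c - b], [b + 1], ... are
    given in simplified form. *)
Lemma hankel_eval (z : nat -> rat) (kap a b c cb b1 ca c1 : rat) n :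
    (forall i, conv (hyp invradius a b c) z i = kap * hyp invradius a (b + 1) (c + 1) i) ->
    0 < a -> 0 < b -> 0 < c -> 0 < cb -> 0 < ca -> kap != 0 ->
    cb = c - b -> b1 = b + 1 -> ca = c - a + 1 -> c1 = c + 1 ->
  hankel z n = \prod_(0 <= i < n)
    (kap * ((poch a i * poch cb i * poch b1 i * poch ca i)
      / (poch c (2 * i) * poch c1 (2 * i))) * invradius ^+ (2 * i)).
Proof.
move=> Hz a0 b0 c0 cb0 ca0 k0 ecb eb eca ec.
rewrite ecb in cb0 *; rewrite eca in ca0 *; rewrite eb ec.
exact: (hankel_gauss invradius_gt0).
Qed.

Lemma hankel1_eval (z : nat -> rat) (kap kap' a b c cb ca c1 : rat) n :
    (forall i, conv (hyp invradius a b c) z i = kap * hyp invradius a (b + 1) (c + 1) i) ->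
    0 < a -> 0 < b -> 0 < c -> 0 < cb -> 0 < ca + 1 -> kap != 0 ->
    cb = c - b -> ca = c - a -> c1 = c - 1 -> ca != 0 -> c1 != 0 ->
    kap' * (invradius * b * ca) = kap * c * c1 ->
  hankel1 z n = \prod_(1 <= i < n.+1)
    (kap' * ((poch a i * poch cb i * poch b i * poch ca i)
      / (poch c (2 * i) * poch c1 (2 * i))) * invradius ^+ (2 * i)).
Proof.
move=> Hz a0 b0 c0 cb0 ca0 k0 ecb eca ec ca1 c10 ek.
have -> : kap' = kap * c * c1 / (invradius * b * ca).
  by rewrite -ek mulfK // !mulf_neq0 // gt_eqF // invradius_gt0.
rewrite ecb in cb0 *; rewrite eca in ca0 ca1 *; rewrite ec in c10 *.
by apply: (hankel1_gauss invradius_gt0); rewrite // -subr_eq0.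
Qed.

(** * The ten determinants *)

Ltac numeric := first [lra | by apply/eqP; lra | by rewrite /invradius; lra].

Theorem mainTheorem4 (n : nat) :
  hankel seq_a n =
    \prod_(0 <= i < n)
      (((poch (2 / 3) i * poch (1 / 6) i * poch (4 / 3) i * poch (5 / 6) i)
        / (poch (1 / 2) (2 * i) * poch (3 / 2) (2 * i)))
        * (27 / 4) ^+ (2 * i)) /\
  hankel1 seq_a n =
    \prod_(1 <= i < n.+1)
      ((2 / 3) * ((poch (2 / 3) i * poch (1 / 6) i * poch (1 / 3) i * poch (- (1 / 6)) i)
        / (poch (1 / 2) (2 * i) * poch (- (1 / 2)) (2 * i)))
        * (27 / 4) ^+ (2 * i)) /\
  hankel seq_b n =
    \prod_(0 <= i < n)
      (((poch (4 / 3) i * poch (5 / 6) i * poch (5 / 3) i * poch (7 / 6) i)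
        / (poch (3 / 2) (2 * i) * poch (5 / 2) (2 * i)))
        * (27 / 4) ^+ (2 * i)) /\
  hankel1 seq_b n =
    \prod_(1 <= i < n.+1)
      (((poch (4 / 3) i * poch (5 / 6) i * poch (2 / 3) i * poch (1 / 6) i)
        / (poch (3 / 2) (2 * i) * poch (1 / 2) (2 * i)))
        * (27 / 4) ^+ (2 * i)) /\
  hankel seq_c n =
    \prod_(0 <= i < n)
      (2 * ((poch (5 / 3) i * poch (7 / 6) i * poch (7 / 3) i * poch (11 / 6) i)
        / (poch (5 / 2) (2 * i) * poch (7 / 2) (2 * i)))
        * (27 / 4) ^+ (2 * i)) /\
  hankel1 seq_c n =
    \prod_(1 <= i < n.+1)
      (((poch (5 / 3) i * poch (7 / 6) i * poch (4 / 3) i * poch (5 / 6) i)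
        / (poch (5 / 2) (2 * i) * poch (3 / 2) (2 * i)))
        * (27 / 4) ^+ (2 * i)) /\
  hankel seq_d n =
    \prod_(0 <= i < n)
      (2 * ((poch (5 / 3) i * poch (1 / 6) i * poch (7 / 3) i * poch (5 / 6) i)
        / (poch (5 / 2) (2 * i) * poch (3 / 2) (2 * i)))
        * (27 / 4) ^+ (2 * i)) /\
  hankel1 seq_d n =
    (-1) ^+ n * \prod_(1 <= i < n.+1)
      (((poch (5 / 3) i * poch (1 / 6) i * poch (4 / 3) i * poch (- (1 / 6)) i)
        / (poch (3 / 2) (2 * i) * poch (1 / 2) (2 * i)))
        * (27 / 4) ^+ (2 * i)) /\
  hankel seq_e n =
    \prod_(0 <= i < n)
      (5 * ((poch (2 / 3) i * poch (7 / 6) i * poch (4 / 3) i * poch (11 / 6) i)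
        / (poch (3 / 2) (2 * i) * poch (5 / 2) (2 * i)))
        * (27 / 4) ^+ (2 * i)) /\
  hankel1 seq_e n =
    \prod_(1 <= i < n.+1)
      (2 * ((poch (2 / 3) i * poch (7 / 6) i * poch (1 / 3) i * poch (5 / 6) i)
        / (poch (3 / 2) (2 * i) * poch (1 / 2) (2 * i)))
        * (27 / 4) ^+ (2 * i)).
Proof.
split; [|split; [|split; [|split; [|split; [|split; [|split; [|split; [|split]]]]]]]].
- rewrite (@hankel_eval seq_a 1 (2/3) (1/3) (1/2) (1/6) (4/3) (5/6) (3/2) n conv_a); [|numeric..].
  by apply: eq_bigr => i _; rewrite mul1r.
- rewrite (@hankel1_eval seq_a 1 (2/3) (2/3) (1/3) (1/2) (1/6) (- (1/6)) (- (1/2)) n conv_a); [reflexivity|numeric..].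
- rewrite (@hankel_eval seq_b 1 (4/3) (2/3) (3/2) (5/6) (5/3) (7/6) (5/2) n conv_b); [|numeric..].
  by apply: eq_bigr => i _; rewrite mul1r.
- rewrite (@hankel1_eval seq_b 1 1 (4/3) (2/3) (3/2) (5/6) (1/6) (1/2) n conv_b); [|numeric..].
  by apply: eq_bigr => i _; rewrite mul1r.
- rewrite (@hankel_eval seq_c 2 (5/3) (4/3) (5/2) (7/6) (7/3) (11/6) (7/2) n conv_c); [reflexivity|numeric..].
- rewrite (@hankel1_eval seq_c 2 1 (5/3) (4/3) (5/2) (7/6) (5/6) (3/2) n conv_c); [|numeric..].
  by apply: eq_bigr => i _; rewrite mul1r.
- rewrite (@hankel_eval seq_d 2 (5/3) (4/3) (3/2) (1/6) (7/3) (5/6) (5/2) n conv_d); [|numeric..].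
  by apply: eq_bigr => i _; rewrite [poch (3 / 2) _ * _]mulrC.
- rewrite (@hankel1_eval seq_d 2 (-1) (5/3) (4/3) (3/2) (1/6) (- (1/6)) (1/2) n conv_d); [|numeric..].
  have -> : (-1) ^+ n = \prod_(1 <= i < n.+1) (-1) :> rat.
    by rewrite prodr_const_nat subn1.
  rewrite -big_split.
  by apply: eq_bigr => i _; rewrite -mulrA.
- rewrite (@hankel_eval seq_e 5 (2/3) (1/3) (3/2) (7/6) (4/3) (11/6) (5/2) n conv_e); [reflexivity|numeric..].
- rewrite (@hankel1_eval seq_e 5 2 (2/3) (1/3) (3/2) (7/6) (5/6) (1/2) n conv_e); [reflexivity|numeric..].
Qed.
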